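(* Consider an affiliation random graph mixture model with $Q\ge 2$ groups (either the binary one or the weighted one), with all parameters other than $\boldsymbol\pi$ held fixed. If $n<Q$, then the group proportions are not identifiable up to label swapping from the joint distribution of $K_n$: there exist $\boldsymbol\pi,\boldsymbol\pi'$ in the open simplex, with $\boldsymbol\pi'$ not a permutation of $\boldsymbol\pi$, which induce the same joint law of $K_n$. Equivalently, identifiability of $\boldsymbol\pi$ up to label swapping from the law of $K_n$ requires $n\ge Q$.
   Context: Random graph mixture model: nodes have i.i.d. latent groups $Z_i\in\{1,\dots,Q\}$ with $\pi_q=\mathbb P(Z_i=q)\in(0,1)$, $\sum_q\pi_q=1$; edge variables $X_{ij}$ ($i<j$) are conditionally independent given all $Z$'s, with law of $X_{ij}$ depending only on $(Z_i,Z_j)$. Binary affiliation model: $X_{ij}\in\{0,1\}$, $\mathbb P(X_{ij}=1\mid Z_i=q,Z_j=l)=\alpha$ if $q=l$, $\beta$ if $q\ne l$. Weighted affiliation model: the conditional law of $X_{ij}$ given $Z_i=q,Z_j=l$ is $\mu_{\rm in}$ if $q=l$ and $\mu_{\rm out}$ if $q\ne l$, where $\mu_{\rm in},\mu_{\rm out}$ are probability measures on $\mathbb N$, $\mathbb R$ or $\mathbb R^s$ (e.g. $\mu=(1-p)\delta_0+pF$ with $F$ having no atom at $0$). $K_n$ denotes the collection of the $\binom n2$ edge variables among a set of $n$ nodes. *)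

(* Defs.v *)
From HB Require Import structures.
From mathcomp Require Import all_boot all_order all_algebra all_fingroup.
Set Implicit Arguments. Unset Strict Implicit. Unset Printing Implicit Defensive.
Import Order.TTheory GRing.Theory Num.Theory.
Local Open Scope ring_scope.

Definition open_simplex (R : realFieldType) (Q : nat) (pi : 'I_Q -> R) : Prop :=
  (forall q, 0 < pi q) /\ \sum_(q < Q) pi q = 1.

Definition is_label_perm (R : realFieldType) (Q : nat) (pi pi' : 'I_Q -> R) : Prop :=
  exists s : {perm 'I_Q}, forall q, pi' q = pi (s q).

(* Binary affiliation model: probability that K_n takes the value x
   (only the entries x i j with i < j are used). *)
Definition binary_affil_law (R : realFieldType) (Q n : nat) (pi : 'I_Q -> R)
  (alpha beta : R) (x : 'I_n -> 'I_n -> bool) : R :=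
  \sum_(z : {ffun 'I_n -> 'I_Q})
    ((\prod_(i < n) pi (z i)) *
     \prod_(i < n) \prod_(j < n | (i < j)%N)
        (if z i == z j then (if x i j then alpha else 1 - alpha)
         else (if x i j then beta else 1 - beta))).

(* Weighted affiliation model: probability that X_ij lies in A i j for all
   i < j, where mu_in, mu_out give the probabilities of the events (of type E)
   under the in-group and out-group edge laws. *)
Definition weighted_affil_law (R : realFieldType) (Q n : nat) (pi : 'I_Q -> R)
  (E : Type) (mu_in mu_out : E -> R) (A : 'I_n -> 'I_n -> E) : R :=
  \sum_(z : {ffun 'I_n -> 'I_Q})
    ((\prod_(i < n) pi (z i)) *
     \prod_(i < n) \prod_(j < n | (i < j)%N)
        (if z i == z j then mu_in (A i j) else mu_out (A i j))).

(* Main.v *)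
(* Write the law of K_n as a sum over labellings z : [n] -> [Q] of
   prod_i pi_(z i) * w z, where w is invariant under relabelling.  Summing out
   the label of one node, it is either a label unused by the other nodes (which
   exists since n < Q), contributing the power sum p_a(pi) = sum_q pi_q^a, or a
   label already used; by induction such a sum with exponents m_i is a
   polynomial in the power sums of pi of degree at most sum_i m_i.  So it
   suffices to find pi, pi' in the open simplex, not related by a permutation,
   with equal power sums in every degree below Q.  By Newton's identities, the
   roots of two monic polynomials of degree Q differing by a constant have this
   property.  The values of f = prod_q (X - (2q+1)) at the even points
   0, 2, ..., 2Q are odd integers of alternating signs, so f + 1/2 has a root
   between any two consecutive ones; normalizing the roots of f and of f + 1/2
   by their common sum gives pi and pi'. *)

Require Import Defs.
From mathcomp Require Import all_boot all_order all_algebra all_fingroup.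
From mathcomp Require Import polyrcf zify.
Import Order.TTheory GRing.Theory Num.Theory.
Set Implicit Arguments. Unset Strict Implicit. Unset Printing Implicit Defensive.
Local Open Scope ring_scope.

Definition power_sum (R : nzRingType) (Q : nat) (x : 'I_Q -> R) (k : nat) : R :=
  \sum_(q < Q) x q ^+ k.

Lemma power_sum_scale (R : comNzRingType) Q (x : 'I_Q -> R) a k :
  power_sum (fun q => x q * a) k = power_sum x k * a ^+ k.
Proof. by rewrite /power_sum mulr_suml; apply: eq_bigr => q _; rewrite exprMn. Qed.

Section NewtonIdentities.
Variable R : comNzRingType.

Lemma deriv_prod (I : eqType) (r : seq I) (F : I -> {poly R}) : uniq r ->
  (\prod_(i <- r) F i)^`() = \sum_(i <- r) (F i)^`() * \prod_(j <- r | j != i) F j.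
Proof.
elim: r => [|a r IHr] /=; first by rewrite !big_nil -polyC1 derivC.
case/andP => a_notin_r uniq_r; rewrite !big_cons derivM IHr // eqxx /=.
congr (_ + _).
  by rewrite -{1}(rem_id a_notin_r) rem_filter // big_filter.
rewrite mulr_sumr; apply: eq_big_seq => i i_in_r.
have a_neq_i : a != i by apply: contraNneq a_notin_r => ->.
by rewrite big_cons a_neq_i mulrCA.
Qed.

Variable Q : nat.
Implicit Types x y : 'I_Q -> R.

Definition prodXsubC x : {poly R} := \prod_(q < Q) ('X - (x q)%:P).
Definition prodXsubC_but x q : {poly R} := \prod_(p < Q | p != q) ('X - (x p)%:P).

Lemma prodXsubC_perm x (s : {perm 'I_Q}) : prodXsubC (fun q => x (s q)) = prodXsubC x.
Proof. by rewrite /prodXsubC [RHS](reindex_inj (@perm_inj _ s)). Qed.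

Lemma deriv_prodXsubC x : (prodXsubC x)^`() = \sum_(q < Q) prodXsubC_but x q.
Proof.
rewrite deriv_prod ?index_enum_uniq //.
by apply: eq_bigr => q _; rewrite derivXsubC mul1r.
Qed.

Lemma coef_prodXsubC_but x q : (prodXsubC_but x q)`_Q.-1 = 1.
Proof.
have monic_but : prodXsubC_but x q \is monic by apply: monic_prod_XsubC.
have : size (prodXsubC x) = Q.+1.
  by rewrite size_prod_XsubC /index_enum -enumT size_enum_ord.
rewrite /prodXsubC (bigD1 q) //= size_monicM ?monicXsubC ?monic_neq0 //.
rewrite size_XsubC => -[size_but].
by rewrite -[Q in _`_Q.-1]size_but -lead_coefE; apply/monicP.
Qed.

Lemma sum_powers_prodXsubC_but x k :
  \sum_(q < Q) x q ^+ k *: prodXsubC_but x q =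
  'X^k * (prodXsubC x)^`() -
    prodXsubC x * \sum_(j < k) power_sum x j *: 'X^(k.-1 - j).
Proof.
have -> : \sum_(j < k) power_sum x j *: 'X^(k.-1 - j) =
    \sum_(q < Q) \sum_(j < k) 'X^(k.-1 - j) * (x q)%:P ^+ j.
  rewrite exchange_big; apply: eq_bigr => j _.
  by rewrite scaler_suml; apply: eq_bigr => q _; rewrite -mul_polyC rmorphXn mulrC.
rewrite deriv_prodXsubC !mulr_sumr -sumrB; apply: eq_bigr => q _.
rewrite /prodXsubC (bigD1 q) //= -/(prodXsubC_but x q).
rewrite mulrAC -subrXX mulrBl opprB addrC subrK.
by rewrite -polyC_exp mul_polyC.
Qed.

Lemma coef_sum_powers_prodXsubC_but x k :
  (\sum_(q < Q) x q ^+ k *: prodXsubC_but x q)`_Q.-1 = power_sum x k.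
Proof.
by rewrite coef_sum; apply: eq_bigr => q _; rewrite coefZ coef_prodXsubC_but mulr1.
Qed.

Lemma power_sum_prodXsubC_addC x y c :
  prodXsubC y = prodXsubC x + c%:P ->
  forall k, (k < Q)%N -> power_sum y k = power_sum x k.
Proof.
move=> yE; elim/ltn_ind => k IHk ltkQ.
set r := \sum_(j < k) power_sum x j *: 'X^(k.-1 - j).
have ry : \sum_(j < k) power_sum y j *: 'X^(k.-1 - j) = r.
  by apply: eq_bigr => j _; rewrite IHk // (ltn_trans _ ltkQ).
have r_high : r`_Q.-1 = 0.
  rewrite coef_sum big1 // => -[j /= ltjk] _.
  rewrite coefZ coefXn (_ : (Q.-1 == k.-1 - j)%N = false) ?mulr0 //.
  by move: ltkQ; clear -ltjk; lia.
(* Both products have the same derivative, and [c%:P * r] has degree below [Q.-1]. *)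
rewrite -!coef_sum_powers_prodXsubC_but !sum_powers_prodXsubC_but ry yE.
by rewrite derivD derivC addr0 mulrDl opprD addrA coefB coefCM r_high mulr0 subr0.
Qed.

End NewtonIdentities.

Section LabelMoments.
Variables (R : numFieldType) (Q : nat).
Local Notation labelling n := {ffun 'I_n -> 'I_Q}.

Definition relabel_invariant n (g : labelling n -> R) :=
  forall (s : {perm 'I_Q}) (z : labelling n), g [ffun i => s (z i)] = g z.

Definition label_moment n (m : 'I_n -> nat) (g : labelling n -> R) (pi : 'I_Q -> R) :=
  \sum_(z : labelling n) (\prod_(i < n) pi (z i) ^+ m i) * g z.

Definition ffun_cons n (q : 'I_Q) (z : labelling n) : labelling n.+1 :=
  [ffun i => if unlift ord0 i is Some j then z j else q].

Lemma ffun_cons0 n q (z : labelling n) : ffun_cons q z ord0 = q.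
Proof. by rewrite ffunE unlift_none. Qed.

Lemma ffun_consS n q (z : labelling n) j : ffun_cons q z (lift ord0 j) = z j.
Proof. by rewrite ffunE liftK. Qed.

Lemma sum_ffun_cons n (F : labelling n.+1 -> R) :
  \sum_(z : labelling n.+1) F z = \sum_(q < Q) \sum_(z : labelling n) F (ffun_cons q z).
Proof.
rewrite pair_big (reindex (fun p => ffun_cons p.1 p.2)) //=.
exists (fun z => (z ord0, [ffun j => z (lift ord0 j)])) => [[q z] _ | z _] /=.
  by rewrite ffun_cons0; congr pair; apply/ffunP => j; rewrite ffunE ffun_consS.
by apply/ffunP => i; rewrite ffunE; case: unliftP => [j ->|->] //; rewrite ffunE.
Qed.

Lemma relabel_ffun_cons n (s : {perm 'I_Q}) q (z : labelling n) :
  [ffun i => s (ffun_cons q z i)] = ffun_cons (s q) [ffun j => s (z j)].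
Proof. by apply/ffunP => i; rewrite !ffunE; case: (unlift ord0 i) => // j; rewrite ffunE. Qed.

Lemma exists_fresh_label n (z : labelling n) : (n < Q)%N -> exists q, q \notin codom z.
Proof.
move=> ltnQ; apply/existsP; rewrite -negb_forall; apply: contraL ltnQ => /forallP z_onto.
rewrite -leqNgt -[Q in (Q <= _)%N]card_ord -[n]card_ord -(size_codom z).
by apply: leq_trans (card_size _); apply/subset_leq_card/subsetP => q _; apply: z_onto.
Qed.

Definition extend_fresh n (g : labelling n.+1 -> R) (z : labelling n) : R :=
  if [pick q | q \notin codom z] is Some q then g (ffun_cons q z) else 0.

Lemma extend_freshE n (g : labelling n.+1 -> R) (z : labelling n) q :
  relabel_invariant g -> q \notin codom z -> g (ffun_cons q z) = extend_fresh g z.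
Proof.
move=> g_inv q_fresh; rewrite /extend_fresh; case: pickP => [q' q'_fresh|]; last first.
  by move/(_ q); rewrite q_fresh.
rewrite -(g_inv (tperm q q')) relabel_ffun_cons tpermL; congr (g (ffun_cons _ _)).
apply/ffunP => j; rewrite ffunE tpermD //.
  by apply: contraNneq q_fresh => ->; apply: codom_f.
by apply: contraNneq q'_fresh => ->; apply: codom_f.
Qed.

Lemma extend_fresh_invariant n (g : labelling n.+1 -> R) :
  (n < Q)%N -> relabel_invariant g -> relabel_invariant (extend_fresh g).
Proof.
move=> ltnQ g_inv s z; have [q q_fresh] := exists_fresh_label z ltnQ.
have sq_fresh : s q \notin codom [ffun j => s (z j)].
  by apply: contra q_fresh => /codomP[j]; rewrite ffunE => /perm_inj ->; apply: codom_f.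
by rewrite -(extend_freshE g_inv q_fresh) -(extend_freshE g_inv sq_fresh) -relabel_ffun_cons.
Qed.

Definition label_count n (z : labelling n) q : nat := #|[pred j | z j == q]|.

Lemma label_count_relabel n (s : {perm 'I_Q}) (z : labelling n) q :
  label_count [ffun j => s (z j)] (s q) = label_count z q.
Proof. by apply: eq_card => j; rewrite !inE ffunE (inj_eq perm_inj). Qed.

(* The excess of repeating the label of coordinate i over taking a fresh label,
   shared evenly among the coordinates that carry this label. *)
Definition extend_repeat n (g : labelling n.+1 -> R) (i : 'I_n) (z : labelling n) : R :=
  (g (ffun_cons (z i) z) - extend_fresh g z) / (label_count z (z i))%:R.

Lemma extend_repeat_invariant n (g : labelling n.+1 -> R) i :
  (n < Q)%N -> relabel_invariant g -> relabel_invariant (extend_repeat g i).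
Proof.
move=> ltnQ g_inv s z.
by rewrite /extend_repeat ffunE label_count_relabel (extend_fresh_invariant ltnQ g_inv)
  -relabel_ffun_cons g_inv.
Qed.

Lemma sum_extend n (g : labelling n.+1 -> R) (z : labelling n) a (pi : 'I_Q -> R) :
  relabel_invariant g ->
  \sum_(q < Q) pi q ^+ a * g (ffun_cons q z) =
  power_sum pi a * extend_fresh g z + \sum_(i < n) pi (z i) ^+ a * extend_repeat g i z.
Proof.
move=> g_inv; set e := extend_fresh g z.
rewrite /power_sum mulr_suml.
rewrite (eq_bigr (fun q => pi q ^+ a * e + pi q ^+ a * (g (ffun_cons q z) - e))); last first.
  by move=> q _; rewrite -mulrDr addrC subrK.
rewrite big_split /=; congr (_ + _).
rewrite (partition_big (fun i => z i) predT) //=; apply: eq_bigr => q _.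
rewrite (eq_bigr (fun=> pi q ^+ a * ((g (ffun_cons q z) - e) / (label_count z q)%:R)));
  last by move=> i /eqP <-.
rewrite sumr_const -/(label_count z q).
have [count0|count_gt0] := posnP (label_count z q).
  have q_fresh : q \notin codom z.
    by apply/codomP => -[j zj]; move/card0_eq: count0 => /(_ j); rewrite inE zj eqxx.
  by rewrite count0 mulr0n (extend_freshE g_inv q_fresh) subrr mulr0.
by rewrite -mulrnAr -(mulr_natr (_ / _)) divfK // pnatr_eq0 -lt0n.
Qed.

Lemma label_moment_cons n (m : 'I_n.+1 -> nat) (g : labelling n.+1 -> R) pi :
  (n < Q)%N -> relabel_invariant g ->
  label_moment m g pi =
    power_sum pi (m ord0) * label_moment (fun j => m (lift ord0 j)) (extend_fresh g) pi
  + \sum_(i < n) label_moment (fun j => m (lift ord0 j) + (j == i) * m ord0)%N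
                              (extend_repeat g i) pi.
Proof.
move=> ltnQ g_inv; set m' := fun j : 'I_n => m (lift ord0 j).
pose P (z : labelling n) := \prod_(j < n) pi (z j) ^+ m' j.
have bump (i : 'I_n) (z : labelling n) :
    \prod_(j < n) pi (z j) ^+ (m' j + (j == i) * m ord0)%N = P z * pi (z i) ^+ m ord0.
  rewrite /P (bigD1 i) //= [in RHS](bigD1 i) //= eqxx mul1n exprD mulrAC.
  by congr (_ * _ * _); apply: eq_bigr => j /negPf ->; rewrite mul0n addn0.
rewrite /label_moment sum_ffun_cons exchange_big /=.
rewrite (eq_bigr (fun z => P z * \sum_(q < Q) pi q ^+ m ord0 * g (ffun_cons q z))); last first.
  move=> z _; rewrite mulr_sumr; apply: eq_bigr => q _.
  rewrite big_ord_recl ffun_cons0 (eq_bigr (fun j => pi (z j) ^+ m' j)); last first.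
    by move=> j _; rewrite ffun_consS.
  by rewrite mulrA (mulrC (pi q ^+ _)).
under eq_bigr => z _ do rewrite sum_extend // mulrDr mulr_sumr.
rewrite big_split /= mulr_sumr exchange_big /=; congr (_ + _).
  by apply: eq_bigr => z _; rewrite mulrCA.
apply: eq_bigr => i _; apply: eq_bigr => z _.
by rewrite bump mulrA.
Qed.

Lemma label_moment_power_sums N pi pi' :
  (forall k, (k <= N)%N -> power_sum pi k = power_sum pi' k) ->
  forall n (m : 'I_n -> nat) (g : labelling n -> R), (n <= Q)%N ->
  relabel_invariant g -> (\sum_(i < n) m i <= N)%N ->
  label_moment m g pi = label_moment m g pi'.
Proof.
move=> eq_power_sums; elim=> [|n IHn] m g ltnQ g_inv.
  by move=> _; apply: eq_bigr => z _; rewrite !big_ord0.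
rewrite big_ord_recl => le_m_N.
rewrite !label_moment_cons //; congr (_ * _ + _).
- exact/eq_power_sums/(leq_trans (leq_addr _ _) le_m_N).
- apply: IHn; [exact: ltnW | exact: extend_fresh_invariant |].
  exact: leq_trans (leq_addl _ _) le_m_N.
apply: eq_bigr => i _; apply: IHn; [exact: ltnW | exact: extend_repeat_invariant |].
rewrite big_split /= [X in (_ + X)%N](bigD1 i) //= eqxx mul1n.
by rewrite [X in (_ + (_ + X))%N]big1 ?addn0 1?addnC // => j /negPf ->.
Qed.

End LabelMoments.

Section ShiftedRoots.
Variables (R : rcfType) (Q : nat).

Definition odd_point (q : 'I_Q) : R := (q%:Z * 2 + 1)%:~R.
Definition even_point (k : nat) : R := (k%:Z * 2)%:~R.
Definition gap (k q : nat) : int := k%:Z * 2 - (q%:Z * 2 + 1).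

Local Notation f := (prodXsubC odd_point).
Local Notation g := (prodXsubC odd_point + 2^-1%:P).

Lemma gap_mul_gt0 k q : q != k -> 0 < gap k q * gap k.+1 q.
Proof. by rewrite /gap; nia. Qed.

Lemma gap_mul_same k : gap k k * gap k.+1 k = -1.
Proof. by rewrite /gap; lia. Qed.

Lemma shift_half_sign_change (a b : int) : a * b < 0 -> (a * 2 + 1) * (b * 2 + 1) < 0.
Proof.
have [a_lt0|a_gt0|->] := ltgtP a 0; last by rewrite mul0r ltxx.
- by rewrite nmulr_rlt0 // => b_gt0; nia.
- by rewrite pmulr_rlt0 // => b_lt0; nia.
Qed.

Lemma horner_odd_points k : f.[even_point k] = (\prod_(q < Q) gap k q)%:~R.
Proof.
by rewrite horner_prod rmorph_prod; apply: eq_bigr => q _; rewrite hornerXsubC rmorphB.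
Qed.

Lemma odd_points_sign_change k : (k < Q)%N ->
  (\prod_(q < Q) gap k q) * (\prod_(q < Q) gap k.+1 q) < 0.
Proof.
move=> ltkQ; rewrite -big_split (bigD1 (Ordinal ltkQ)) //= gap_mul_same mulN1r oppr_lt0.
by apply: prodr_gt0 => q q_neq_k; apply: gap_mul_gt0.
Qed.

Lemma shifted_sign_change k : (k < Q)%N ->
  g.[even_point k] * g.[even_point k.+1] < 0.
Proof.
move=> ltkQ.
have twice_g j : 2 * g.[even_point j] = ((\prod_(q < Q) gap j q) * 2 + 1)%:~R.
  rewrite hornerD hornerC horner_odd_points mulrDr mulfV ?pnatr_eq0 //.
  by rewrite rmorphD rmorphM mulrC.
have : (2 * g.[even_point k]) * (2 * g.[even_point k.+1]) < 0.
  by rewrite !twice_g -rmorphM ltrz0 shift_half_sign_change ?odd_points_sign_change.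
by rewrite mulrACA pmulr_rlt0 ?mulr_gt0 ?ltr0n.
Qed.

Lemma even_point_le k : even_point k <= even_point k.+1.
Proof. by rewrite ler_int; lia. Qed.

Definition shifted_root (k : 'I_Q) : R :=
  s2val (poly_ivtoo (even_point_le k) (shifted_sign_change (ltn_ord k))).

Lemma shifted_root_itv k : shifted_root k \in `]even_point k, even_point k.+1[.
Proof. exact: (s2valP (poly_ivtoo _ _)). Qed.

Lemma root_shifted_root k : root g (shifted_root k).
Proof. exact: (s2valP' (poly_ivtoo _ _)). Qed.

Lemma shifted_root_gt0 k : 0 < shifted_root k.
Proof.
have /andP[lt_k _] := shifted_root_itv k.
by apply: le_lt_trans lt_k; rewrite ler0z; lia.
Qed.

Lemma shifted_root_lt (j k : 'I_Q) : (j < k)%N -> shifted_root j < shifted_root k.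
Proof.
move=> ltjk; have /andP[_ lt_j] := shifted_root_itv j.
have /andP[lt_k _] := shifted_root_itv k.
by apply: (lt_trans lt_j); apply: le_lt_trans lt_k; rewrite ler_int; lia.
Qed.

Lemma shifted_root_inj : injective shifted_root.
Proof.
move=> j k eq_jk; apply: val_inj.
have [lt_jk|lt_kj|//] := ltngtP j k.
  by have := shifted_root_lt lt_jk; rewrite eq_jk ltxx.
by have := shifted_root_lt lt_kj; rewrite eq_jk ltxx.
Qed.

Lemma prodXsubC_shifted_root : (0 < Q)%N -> prodXsubC shifted_root = g.
Proof.
move=> Q_gt0.
have size_f : size f = Q.+1.
  by rewrite size_prod_XsubC /index_enum -enumT size_enum_ord.
have size_c : (size (2^-1%:P : {poly R}) < size f)%N.
  by rewrite size_f; apply: leq_ltn_trans (size_polyC_leq1 _) _.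
have lead_g : lead_coef g = 1 by rewrite lead_coefDl // lead_coef_prod_XsubC.
symmetry.
rewrite [LHS](@all_roots_prod_XsubC _ _ [seq shifted_root k | k <- index_enum 'I_Q]).
- by rewrite lead_g scale1r big_map.
- by rewrite size_polyDl // size_map /index_enum -enumT size_enum_ord.
- by apply/allP => _ /mapP[k _ ->]; apply: root_shifted_root.
by rewrite uniq_rootsE (map_inj_uniq shifted_root_inj) index_enum_uniq.
Qed.

End ShiftedRoots.

Lemma power_sum1_gt0 (R : numDomainType) Q (x : 'I_Q -> R) :
  (0 < Q)%N -> (forall q, 0 < x q) -> 0 < power_sum x 1.
Proof.
move=> Q_gt0 x_gt0; rewrite /power_sum (bigD1 (Ordinal Q_gt0)) //= expr1 ltr_pwDl //.
by apply: sumr_ge0 => q _; rewrite expr1 ltW.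
Qed.

Lemma open_simplex_normalize (R : realFieldType) Q (x : 'I_Q -> R) :
  (0 < Q)%N -> (forall q, 0 < x q) -> open_simplex (fun q => x q / power_sum x 1).
Proof.
move=> Q_gt0 x_gt0; have sum_gt0 := power_sum1_gt0 Q_gt0 x_gt0.
split=> [q|]; first by rewrite divr_gt0.
by rewrite -mulr_suml (eq_bigr _ (fun q _ => esym (expr1 (x q)))) divff ?gt_eqF.
Qed.

Lemma exists_power_sum_twins (R : rcfType) Q : (2 <= Q)%N ->
  exists pi pi' : 'I_Q -> R,
    [/\ open_simplex pi, open_simplex pi', ~ is_label_perm pi pi' &
        forall k, (k < Q)%N -> power_sum pi k = power_sum pi' k].
Proof.
move=> leQ2; have Q_gt0 : (0 < Q)%N by apply: ltn_trans leQ2.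
set x := @odd_point R Q; set y := @shifted_root R Q.
have eq_power_sums := power_sum_prodXsubC_addC (prodXsubC_shifted_root R Q_gt0).
have x_gt0 q : 0 < x q by rewrite ltr0z; lia.
have S_gt0 := power_sum1_gt0 Q_gt0 x_gt0; set S := power_sum x 1 in S_gt0 *.
have yS : power_sum y 1 = S by apply: eq_power_sums.
exists (fun q => x q / S), (fun q => y q / S); split.
- exact: open_simplex_normalize.
- by rewrite -yS; apply: open_simplex_normalize => //; apply: shifted_root_gt0.
- move=> [s eq_ys]; have y_perm q : y q = x (s q).
    by apply: (mulIf (_ : S^-1 != 0)); rewrite ?eq_ys // invr_eq0 gt_eqF.
  have : prodXsubC y = prodXsubC x.
    by rewrite -(prodXsubC_perm x s); apply: eq_bigr => q _; rewrite y_perm.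
  rewrite prodXsubC_shifted_root // => /eqP; rewrite -subr_eq0 addrC addKr polyC_eq0.
  by rewrite invr_eq0 pnatr_eq0.
- by move=> k ltkQ; rewrite !power_sum_scale eq_power_sums.
Qed.

Lemma affiliation_sum_power_sums (R : numFieldType) Q n (pi pi' : 'I_Q -> R)
    (a b : 'I_n -> 'I_n -> R) :
  (n < Q)%N -> (forall k, (k < Q)%N -> power_sum pi k = power_sum pi' k) ->
  \sum_(z : {ffun 'I_n -> 'I_Q}) (\prod_(i < n) pi (z i)) *
     \prod_(i < n) \prod_(j < n | (i < j)%N) (if z i == z j then a i j else b i j) =
  \sum_(z : {ffun 'I_n -> 'I_Q}) (\prod_(i < n) pi' (z i)) *
     \prod_(i < n) \prod_(j < n | (i < j)%N) (if z i == z j then a i j else b i j).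
Proof.
move=> ltnQ eq_power_sums.
pose w (z : {ffun 'I_n -> 'I_Q}) :=
  \prod_(i < n) \prod_(j < n | (i < j)%N) (if z i == z j then a i j else b i j).
have w_inv : relabel_invariant w.
  move=> s z; apply: eq_bigr => i _; apply: eq_bigr => j _.
  by rewrite !ffunE (inj_eq perm_inj).
have moment pi0 : \sum_(z : {ffun 'I_n -> 'I_Q}) (\prod_(i < n) pi0 (z i)) * w z =
                  label_moment (fun=> 1%N) w pi0.
  by apply: eq_bigr => z _; congr (_ * _); apply: eq_bigr => i _; rewrite expr1.
rewrite !moment; apply: (label_moment_power_sums (N := n)) => //.
- by move=> k lekn; apply/eq_power_sums/(leq_ltn_trans lekn).
- exact: ltnW.
- by rewrite sum_nat_const card_ord muln1.
Qed.

Theorem proposition3 (R : rcfType) (Q n : nat) (hQ : (2 <= Q)%N) (hn : (n < Q)%N) :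
  (forall alpha beta : R, 0 <= alpha <= 1 -> 0 <= beta <= 1 ->
     exists pi pi' : 'I_Q -> R,
       [/\ open_simplex pi, open_simplex pi', ~ is_label_perm pi pi' &
           forall x : 'I_n -> 'I_n -> bool,
             binary_affil_law pi alpha beta x = binary_affil_law pi' alpha beta x])
  /\
  (forall (S : Type) (mu_in mu_out : (S -> Prop) -> R),
     exists pi pi' : 'I_Q -> R,
       [/\ open_simplex pi, open_simplex pi', ~ is_label_perm pi pi' &
           forall A : 'I_n -> 'I_n -> (S -> Prop),
             weighted_affil_law pi mu_in mu_out A = weighted_affil_law pi' mu_in mu_out A]).
Proof.
have [pi [pi' [simplex_pi simplex_pi' not_perm eq_power_sums]]] :=
  exists_power_sum_twins R hQ.
split.
- move=> alpha beta _ _; exists pi, pi'; split=> // x.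
  exact: (affiliation_sum_power_sums (fun i j => if x i j then alpha else 1 - alpha)
                                     (fun i j => if x i j then beta else 1 - beta) hn).
- move=> S mu_in mu_out; exists pi, pi'; split=> // A.
  exact: (affiliation_sum_power_sums (fun i j => mu_in (A i j))
                                     (fun i j => mu_out (A i j)) hn).
Qed.
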